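(* Assume that $\beta\ge0$, $\beta\ne1/2$, and let $\widetilde B$ be a Brownian motion with diffusion coefficient $\sqrt{1+\eta}\in(1,\sqrt2]$. Then there exists a constant $C_\eta$ such that for all $(x,y,z)\in\mathbb{R}^3$ with $y\ne z$, $$\mathbb{E}_y\left[\int_0^{\Delta_n}\frac{dL^z_s(\widetilde B)}{s^\beta}\ \Big|\ \widetilde B_{\Delta_n}=x\right]\le C_\eta\,\Delta_n^{1/2-\beta}\left(1+\left|\frac{y-z}{\sqrt{\Delta_n}}\right|^{(1-2\beta)\wedge0}e^{-\frac{(y-z)^2}{\eta\Delta_n}}\,e^{\eta\frac{(x-y)^2}{\Delta_n}}\right).$$ Moreover, for $\beta\in[0,1/2)$ the inequality holds true also for $y=z$.
   Context: $\Delta_n>0$ is the sampling step ($\Delta_n\to0$); the constant $C_\eta$ does not depend on $x,y,z$ or $\Delta_n$ ($\beta$ is fixed). A Brownian motion with diffusion coefficient $\sigma$ is $\sigma$ times a standard Brownian motion (with arbitrary starting point). $\mathbb{E}_y[\cdot]$ is the expectation given $\widetilde B_0=y$, and the conditional expectation is under the Brownian bridge from $y$ at time $0$ to $x$ at time $\Delta_n$. $(L^z_t(\widetilde B))_t$ is the (semimartingale) local time at level $z$ of $\widetilde B$. *)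

(* Defs.v *)
From HB Require Import structures.
From mathcomp Require Import all_boot all_order all_algebra.
From mathcomp Require Import all_classical all_reals all_analysis.

Set Implicit Arguments.
Unset Strict Implicit.
Unset Printing Implicit Defensive.

Import Order.TTheory GRing.Theory Num.Theory.
Import numFieldNormedType.Exports.

Local Open Scope classical_set_scope.
Local Open Scope ring_scope.

(* Transition density over a time t > 0 of [sigma] times a standard Brownian
   motion: the law at time t, started from u, is N(u, sigma ^+ 2 * t). *)
Definition bm_density (R : realType) (sigma t u v : R) : R :=
  normal_pdf u (sigma * Num.sqrt t) v.

(* For s < t_1 < ... < t_n < T, the density at x of the sub-probability
     P (B_{t_1} \in A_1, ..., B_{t_n} \in A_n, B_T \in dx | B_s = u)
   where B is a Brownian motion with diffusion coefficient sigma and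
   l = [:: (t_1, A_1); ...; (t_n, A_n)]. *)
Fixpoint bm_joint_density (R : realType) (sigma T x s u : R)
    (l : seq (R * set R)) : \bar R :=
  match l with
  | [::] => (bm_density sigma (T - s) u x)%:E
  | (t, A) :: l' =>
      (\int[lebesgue_measure]_(v in A)
         ((bm_density sigma (t - s) u v)%:E *
          bm_joint_density sigma T x t v l'))%E
  end.

(* Under P, the process B on [0, T] is the bridge from y at time 0 to x at
   time T of the Brownian motion with diffusion coefficient sigma; in other
   words P is the conditional probability P_y ( . | B_T = x).  The last field
   is Bayes' rule for the finite-dimensional distributions, multiplied out by
   the density at x of B_T given B_0 = y, which is positive. *)
Record is_brownian_bridge (d : measure_display) (Omega : measurableType d)
    (R : realType) (P : probability Omega R) (B : R -> Omega -> R)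
    (sigma T y x : R) : Prop := {
  bridge_measurable : forall t, t \in `[0, T] -> measurable_fun setT (B t) ;
  bridge_continuous :
    {ae P, forall w, {within `[0, T], continuous (fun t => B t w)}} ;
  bridge_start : {ae P, forall w, B 0 w = y} ;
  bridge_end : {ae P, forall w, B T w = x} ;
  bridge_fdd : forall l : seq (R * set R),
    path <%R 0 (rcons [seq p.1 | p <- l] T) ->
    (forall i, (i < size l)%N -> measurable (nth (0, setT) l i).2) ->
    (P (\big[setI/setT]_(p <- l) (B p.1 @^-1` p.2)) *
      (bm_density sigma T y x)%:E = bm_joint_density sigma T x 0 y l)%E
}.

(* L is (on [0, T]) a version of the semimartingale local time at level z of
   B, whose bracket is d<B>_s = sigma ^+ 2 ds: almost surely, for every t,
     L_t = lim_(e -> 0+) 1/e * \int_0^t 1_(z <= B_s < z + e) d<B>_s.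
   With this normalization the occupation times formula reads
   \int_0^t f(B_s) d<B>_s = \int f(z) L^z_t dz.  The paths of L are taken in
   [cumulative R R] so that the Stieltjes measure dL is defined. *)
Record is_local_time (d : measure_display) (Omega : measurableType d)
    (R : realType) (P : probability Omega R) (B : R -> Omega -> R)
    (sigma T z : R) (L : Omega -> cumulative R R) : Prop := {
  local_time_measurable :
    forall t, t \in `[0, T] -> measurable_fun setT (fun w => L w t) ;
  local_time_limit :
    {ae P, forall w, forall t, t \in `[0, T] ->
      e^-1 * (\int[lebesgue_measure]_(s in `[0%R, t])
                (\1_(`[z, z + e[) (B s w) * sigma ^+ 2))
        @[e --> 0^'+] --> L w t}
}.

(* Main.v *)
Require Import Defs.
From HB Require Import structures.
From mathcomp Require Import all_boot all_order all_algebra.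
From mathcomp Require Import all_classical all_reals all_analysis.
From mathcomp Require Import measurable_realfun lra ring.

Set Implicit Arguments.
Unset Strict Implicit.
Unset Printing Implicit Defensive.

Import Order.TTheory GRing.Theory Num.Theory.
Import numFieldNormedType.Exports.

Local Open Scope classical_set_scope.
Local Open Scope ring_scope.

(** Write [T] for the horizon, [f s = s `^ (- beta)], [w = y - z] and
[b = x - y].  On [[0, T]], the measure [dL] is almost surely the weak limit, as
[e] tends to 0 from above, of the occupation measures
[mu_e (ds) = (1 + eta) / e * 1(z <= B_s < z + e) ds].

Since [f] is nonincreasing, [\int f dL] is a limit of lower sums, each of which is
a finite combination of increments of [L] with nonnegative coefficients, so that
[\int f dL <= liminf \int f dmu_e] on every good path
([stieltjes_le_limn_einf]).  Fatou's lemma then bounds the expectation of the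
left-hand side by the liminf of [E \int f dmu_e], which by Tonelli's theorem is
[\int_0^T f s * (1 + eta) / e * P (z <= B_s < z + e) ds].

It remains to bound, uniformly for [v] in [[z, z + e)], the density at [v] of
[B_s] under the bridge.  With [a = v - y] it is at most
[sqrt (T / (s (T - s))) * exp (- (T a - s b)^2 / (2 (1 + eta) s (T - s) T))]
([bridge_density_le], [bridge_exponentE]).  Time is cut at [eta T / 64].
- After the cut, the exponential is dropped, and what remains of the integral is
  at most of order [T^(1/2 - beta)]: this is the summand 1 of the estimate.
- Before the cut, as soon as [|a| >= |w| / 2], the exponent is at most
  [- w^2 / (64 s) - w^2 / (eta T) + eta b^2 / T]
  ([bridge_exponent_small_time]).  The last two terms are the exponential factors
  of the estimate.  The first one gives the integral of
  [s^(- beta - 1/2) exp (- w^2 / (64 s))], which is at most of order [T^(1/2 - beta)]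
  if [beta < 1/2] and [|w|^(1 - 2 beta)] if [beta > 1/2] ([small_time_integral_le]).
Every level [v] in [[z, z + e)] satisfies [|v - y| >= |w| / 2] when
[e <= |w| / 2], so the same constant serves for all small [e]. *)

(** * Integrals and lower limits of nonnegative functions *)

(** The integral of a nonnegative function is a supremum over the simple functions
below it, so monotonicity holds for functions that need not be measurable. *)
Lemma le_integral_pointwise (d : measure_display) (T : measurableType d) (R : realType)
    (mu : {measure set T -> \bar R}) (D : set T) (f g : T -> \bar R) :
  (forall x, D x -> (0 <= f x)%E) -> (forall x, D x -> (f x <= g x)%E) ->
  (\int[mu]_(x in D) f x <= \int[mu]_(x in D) g x)%E.
Proof.
move=> f0 fg.
have g0 x : D x -> (0 <= g x)%E by move=> Dx; exact: le_trans (f0 x Dx) (fg x Dx).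
rewrite !ge0_integralE//; apply: ge_ereal_sup => _ [h hf <-] /=; apply: ereal_sup_ubound; exists h => // x.
by apply: le_trans (hf x) _; apply: lee_restrict.
Qed.

(** Meant for [f] the Stieltjes integral against a path of the local time, as a
function of the path, and [g] a lower limit of measurable functions. *)
Lemma le_integral_ae_pointwise (d : measure_display) (T : measurableType d) (R : realType)
    (mu : {measure set T -> \bar R}) (f g : T -> \bar R) :
  measurable_fun setT g ->
  (forall x, (0 <= f x)%E) -> (forall x, (0 <= g x)%E) ->
  {ae mu, forall x, (f x <= g x)%E} ->
  (\int[mu]_x f x <= \int[mu]_x g x)%E.
Proof.
move=> mg f0 g0 [N [mN N0 sN]].
(* On the exceptional set, replacing [g] by infinity costs nothing and makes the
   inequality hold everywhere. *)
pose g' x := if x \in N then +oo%E else g x.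
have mg' : measurable_fun setT g'.
  apply: measurable_fun_ifT => //.
  apply: (@measurable_fun_bool _ _ _ _ true).
  by rewrite setTI (_ : _ @^-1` _ = N)//; apply/seteqP; split => [x /set_mem|x /mem_set].
have g'0 x : (0 <= g' x)%E by rewrite /g'; case: ifP.
have -> : (\int[mu]_x g x = \int[mu]_x g' x)%E.
  apply: ge0_ae_eq_integral => //.
  exists N; split => // x /= h; apply: contrapT => Nx; apply: h => _.
  by rewrite /g' memNset.
apply: le_integral_pointwise => // x _; rewrite /g'.
case: ifPn => [_|]; first exact: leey.
rewrite notin_setE => Nx; apply: contrapT => h; exact/Nx/sN.
Qed.

Lemma integral_le_exhaust (d : measure_display) (T : measurableType d) (R : realType)
    (mu : {measure set T -> \bar R}) (F : (set T)^nat) (f : T -> \bar R)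
    (M : \bar R) :
  nondecreasing_seq F -> (forall i, measurable (F i)) ->
  measurable_fun (\bigcup_i F i) f ->
  (forall x, (\bigcup_i F i) x -> (0 <= f x)%E) ->
  (forall i, (\int[mu]_(x in F i) f x <= M)%E) ->
  (\int[mu]_(x in \bigcup_i F i) f x <= M)%E.
Proof.
move=> ndF mF mf f0 fM.
have mf' i : measurable_fun (F i) f.
  by apply: measurable_funS mf; [exact: bigcup_measurable|exact: bigcup_sup].
have f0' i x : F i x -> (0 <= f x)%E by move=> Fx; apply: f0; exists i.
have cv := @ge0_nondecreasing_set_cvg_integral _ _ _ F f mu ndF mF mf' f0'.
rewrite -(cvg_lim _ cv)//; apply: lime_le; first by apply/cvg_ex; eexists; exact: cv.
by apply: nearW.
Qed.

Lemma le_limn_einf_cvg (R : realType) (u v : (\bar R)^nat) (l : \bar R) :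
  u @ \oo --> l -> (forall n, (u n <= v n)%E) -> (l <= limn_einf v)%E.
Proof.
move=> ul uv; rewrite -(cvg_limn_einf_sup ul).1 !limn_einf_lim.
apply: lee_lim; [exact: is_cvg_einfs|exact: is_cvg_einfs|].
apply: nearW => n; apply: le_ereal_inf_tmp => _ [m /= nm <-].
by apply: le_trans (uv m); apply: ereal_inf_lbound; exists m.
Qed.

Lemma limn_einf_le_bound (R : realType) (v : (\bar R)^nat) (l : \bar R) :
  (forall n, (v n <= l)%E) -> (limn_einf v <= l)%E.
Proof.
move=> vl; rewrite limn_einf_lim; apply: lime_le; first exact: is_cvg_einfs.
apply: nearW => n; apply: le_trans (vl n); apply: ereal_inf_lbound.
by exists n => /=.
Qed.

Lemma measurable_limn_einf (d : measure_display) (T : measurableType d) (R : realType)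
    (f : nat -> T -> \bar R) :
  (forall n, measurable_fun setT (f n)) ->
  measurable_fun setT (fun x => limn_einf (fun n => f n x)).
Proof.
move=> mf; apply: (emeasurable_fun_cvg (fun n x => einfs (fun n => f n x) n)).
  by move=> n; exact: measurable_fun_einfs.
by move=> x _; rewrite limn_einf_lim; exact: is_cvg_einfs.
Qed.

(** * Integrals of powers *)

(** Improper integrals on a bounded open interval: the fundamental theorem on a
compact subinterval gives a difference of two values of the primitive, and
boundedness of the primitive makes this uniform in the subinterval. *)
Lemma integral_derive_le (R : realType) (F f : R -> R) (a b m M : R) : a < b ->
  (forall x : R, x \in `]a, b[ -> is_derive x 1 F (f x)) ->
  {in `]a, b[, continuous f} ->
  {in `]a, b[, forall x, 0 <= f x} ->
  {in `]a, b[, forall x, m <= F x <= M} ->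
  (\int[lebesgue_measure]_(x in `]a, b[) (f x)%:E <= (M - m)%:E)%E.
Proof.
move=> ab dF cf f0 Fb.
pose c := (b - a) / 2.
pose G (n : nat) : set R := `[a + c / n.+2%:R, b - c / n.+2%:R]%classic.
have c0 : 0 < c by rewrite divr_gt0 // subr_gt0.
have cn n : 0 < c / n.+2%:R by rewrite divr_gt0.
have cn2 n : c / n.+2%:R <= c / 2.
  by rewrite ler_pM2l// lef_pV2 ?posrE// ler_nat.
have subG n : G n `<=` `]a, b[.
  rewrite /G => x /=; rewrite !in_itv/= => /andP[]; have := cn n.
  by move: (c / _) => t ? ? ?; apply/andP; split; lra.
have -> : `]a, b[%classic = \bigcup_i G i.
  apply/seteqP; split => [x /=|x [n _ /subG//]].
  rewrite in_itv/= => /andP[ax xb].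
  pose e := Num.min (x - a) (b - x).
  have e0 : 0 < e by rewrite lt_min !subr_gt0 ax xb.
  have /ltr_add_invr[k] : (0 : R) < e / c by rewrite divr_gt0.
  rewrite add0r => hk.
  have hk' : c / k.+2%:R < e.
    rewrite mulrC -ltr_pdivlMr//; apply: le_lt_trans hk.
    by rewrite lef_pV2 ?posrE// ler_nat.
  exists k => //; rewrite /G /= in_itv/=.
  by move: hk'; rewrite lt_min; move: (c / _) => t /andP[? ?]; apply/andP; split; lra.
have fcont : measurable_fun (`]a, b[ : set R) f.
  apply: subspace_continuous_measurable_fun => //.
  by rewrite continuous_open_subspace// => x /[!inE]; exact: cf.
apply: integral_le_exhaust.
- apply/nondecreasing_seqP => n; apply/subsetPset => x; rewrite /G /= !in_itv/=.
  have : c / n.+3%:R <= c / n.+2%:R by rewrite ler_pM2l// lef_pV2 ?posrE// ler_nat.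
  by move: (c / _) (c / _) => s t ? /andP[? ?]; apply/andP; split; lra.
- by move=> n; exact: measurable_itv.
- apply/measurable_EFinP; apply: measurable_funS fcont => //.
  by move=> x [n _ /subG].
- by move=> x [n _ /subG xab]; rewrite lee_fin; exact: f0.
move=> n; rewrite /G.
set a' := a + _; set b' := b - _.
have ab' : a' < b' by have := cn2 n; rewrite /a' /b'; move: (c / n.+2%:R) => t; rewrite /c => ?; lra.
have sub x : a' <= x <= b' -> x \in `]a, b[.
  by move=> h; apply: (subG n); rewrite /G /= in_itv.
have cF x : x \in `]a, b[ -> F y @[y --> x] --> F x.
  by move=> /dF [] /derivable1_diffP/differentiable_continuous.
have a'i : a' \in `]a, b[ by apply: sub; rewrite lexx ltW.
have b'i : b' \in `]a, b[ by apply: sub; rewrite lexx ltW.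
rewrite (@continuous_FTC2 _ f F)//.
- rewrite -EFinB lee_fin.
  have /andP[? ?] := Fb _ a'i; have /andP[? ?] := Fb _ b'i; lra.
- apply: continuous_in_subspaceT => x /[!inE] /=; rewrite in_itv/= => /sub; exact: cf.
- split.
  + by move=> x /subset_itv_oo_cc; rewrite /= in_itv/= => /sub/dF[].
  + exact/cvg_at_right_filter/cF.
  + exact/cvg_at_left_filter/cF.
- move=> x /subset_itv_oo_cc; rewrite /= in_itv/= => /sub/dF; rewrite derive1E => ?.
  exact: derive_val.
Qed.

Lemma powR_continuous_at (R : realType) (p x : R) : 0 < x ->
  {for x, continuous (fun y : R => y `^ p)}.
Proof.
by move=> /(@is_derive1_powR R p)[/derivable1_diffP/differentiable_continuous].
Qed.

Lemma integral_powR_0_le (R : realType) (alpha c : R) : alpha < 1 -> 0 < c ->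
  (\int[lebesgue_measure]_(x in `]0%R, c[) (x `^ (- alpha))%:E
     <= (c `^ (1 - alpha) / (1 - alpha))%:E)%E.
Proof.
move=> al c0.
have b0 : 0 < 1 - alpha by rewrite subr_gt0.
rewrite -[X in (_ <= X%:E)%E]subr0.
apply: (@integral_derive_le _ (fun x => x `^ (1 - alpha) / (1 - alpha))) => //.
- move=> x; rewrite in_itv/= => /andP[x0 _].
  rewrite (_ : x `^ _ = (1 - alpha)^-1 *: ((1 - alpha) * x `^ (1 - alpha - 1))); last first.
    by rewrite /GRing.scale/= mulKf ?gt_eqF// addrC addrA addNr add0r.
  under eq_fun do rewrite mulrC.
  exact/is_deriveZ/is_derive1_powR.
- move=> x; rewrite in_itv/= => /andP[x0 _]; exact: powR_continuous_at.
- by move=> x _; exact: powR_ge0.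
- move=> x; rewrite in_itv/= => /andP[x0 xc].
  rewrite divr_ge0 ?powR_ge0 ?(ltW b0)//= ler_pM2r ?invr_gt0//.
  by apply: ge0_ler_powR; rewrite ?nnegrE ltW.
Qed.

Lemma integral_powR_tail_le (R : realType) (alpha c d : R) : 1 < alpha -> 0 < c -> c < d ->
  (\int[lebesgue_measure]_(x in `]c, d[) (x `^ (- alpha))%:E
     <= (c `^ (1 - alpha) / (alpha - 1))%:E)%E.
Proof.
move=> al c0 cd.
have b0 : 0 < alpha - 1 by rewrite subr_gt0.
rewrite -[X in (_ <= X%:E)%E]opprK -[X in (_ <= X%:E)%E]add0r.
apply: (@integral_derive_le _ (fun x => - (x `^ (1 - alpha) / (alpha - 1))) _ _ _
  (- (c `^ (1 - alpha) / (alpha - 1))) 0).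
- exact: cd.
- move=> x; rewrite in_itv/= => /andP[x0 _].
  rewrite (_ : x `^ _ = (1 - alpha)^-1 *: ((1 - alpha) * x `^ (1 - alpha - 1))); last first.
    rewrite /GRing.scale/= mulKf ?lt_eqF ?subr_lt0//.
    by rewrite addrC addrA addNr add0r.
  rewrite (_ : (fun _ => _) = (fun x => (1 - alpha)^-1 * x `^ (1 - alpha))).
    by apply/is_deriveZ/is_derive1_powR; exact: lt_trans c0 x0.
  by apply/funext => y; rewrite mulrC -mulNr -invrN opprB.
- move=> x; rewrite in_itv/= => /andP[x0 _]; apply: powR_continuous_at.
  exact: lt_trans c0 x0.
- by move=> x _; exact: powR_ge0.
- move=> x; rewrite in_itv/= => /andP[x0 xc].
  rewrite oppr_le0 divr_ge0 ?powR_ge0 ?(ltW b0)//= andbT lerN2 ler_pM2r ?invr_gt0//.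
  rewrite -opprB !powRN lef_pV2 ?posrE ?powR_gt0// ?(lt_trans c0 x0)//.
  by apply: ge0_ler_powR; rewrite ?nnegrE ltW// (lt_trans c0 x0).
Qed.

Lemma integral_powR_right_le (R : realType) (c T : R) : 0 <= c -> c < T ->
  (\int[lebesgue_measure]_(x in `]c, T[) ((T - x) `^ (- 2^-1))%:E
     <= (2 * T `^ 2^-1)%:E)%E.
Proof.
move=> c0 cT.
rewrite -[X in (_ <= X%:E)%E]opprK -[X in (_ <= X%:E)%E]add0r.
apply: (@integral_derive_le _ (fun x => - (2 * (T - x) `^ 2^-1)) _ _ _
  (- (2 * T `^ 2^-1)) 0).
- exact: cT.
- move=> x; rewrite in_itv/= => /andP[_ xT].
  have Tx : 0 < T - x by rewrite subr_gt0.
  have h := @is_derive1_powR R (2^-1) _ Tx.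
  have -> : (T - x) `^ (- 2^-1) = (-2) *: ((2^-1 * (T - x) `^ (2^-1 - 1)) * (- 1)).
    by rewrite /GRing.scale/= (_ : 2^-1 - 1 = - 2^-1 :> R); lra.
  under eq_fun do rewrite -mulNr.
  apply: is_deriveZ.
  have h' : is_derive x 1 (fun x : R => T - x) (-1).
    by rewrite -[X in is_derive _ _ _ X]add0r; apply: is_deriveB.
  exact: (@is_derive1_comp _ (fun y => y `^ _) (fun x => T - x) x).
- move=> x; rewrite in_itv/= => /andP[_ xT].
  apply: (@continuous_comp _ _ _ (fun x => T - x) (fun y => y `^ _)).
    by apply: cvgB; [exact: cvg_cst|exact: cvg_id].
  by apply: powR_continuous_at; rewrite subr_gt0.
- by move=> x _; exact: powR_ge0.
- move=> x; rewrite in_itv/= => /andP[x0 xT].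
  rewrite oppr_le0 mulr_ge0 ?powR_ge0//= andbT lerN2 ler_pM2l//.
  by apply: ge0_ler_powR; rewrite ?nnegrE ?invr_ge0//; lra.
Qed.

(** Raise [x / p <= expR (x / p)] to the power [p]. *)
Lemma powR_mul_expRN_le (R : realType) (p x : R) : 0 < p -> 0 < x ->
  x `^ p * expR (- x) <= p `^ p.
Proof.
move=> p0 x0; rewrite expRN ler_pdivrMr ?expR_gt0//.
have -> : expR x = (expR (x / p)) `^ p.
  by rewrite -expRM divfK ?gt_eqF.
rewrite -powRM ?expR_ge0 ?(ltW p0)//.
apply: ge0_ler_powR; rewrite ?nnegrE ?(ltW p0) ?(ltW x0) ?mulr_ge0 ?expR_ge0 ?(ltW p0)//.
rewrite mulrC -ler_pdivrMr//; apply: le_trans (expR_ge1Dx _); lra.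
Qed.

Lemma powR_mul_expRV_continuous (R : realType) (alpha c x : R) : 0 < x ->
  {for x, continuous (fun r : R => r `^ (- alpha) * expR (- (c / r)))}.
Proof.
move=> x0; apply: cvgM; first exact: powR_continuous_at.
apply: continuous_comp; last exact: continuous_expR.
apply: cvgN; apply: cvgM; first exact: cvg_cst.
by apply: cvgV; [rewrite gt_eqF|exact: cvg_id].
Qed.

(** The integrand is cut at the diffusive scale [A].  Below it, the exponential beats
the singularity, and the integrand is at most a multiple of [A `^ (- alpha)];
above it, the exponential is at most 1 and the power is integrable at infinity. *)
Lemma integral_powR_expRV_le (R : realType) (alpha k A d : R) :
  1 < alpha -> 0 < k -> 0 < A -> 0 < d ->
  (\int[lebesgue_measure]_(r in `]0%R, d[) (r `^ (- alpha) * expR (- (k * A / r)))%:E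
   <= (((alpha / k) `^ alpha + (alpha - 1)^-1) * A `^ (1 - alpha))%:E)%E.
Proof.
move=> al k0 A0 d0.
pose f (r : R) := r `^ (- alpha) * expR (- (k * A / r)).
have f0 r : 0 <= f r by rewrite mulr_ge0 ?powR_ge0 ?expR_ge0.
have mf : measurable_fun (`]0, A + d[ : set R) f.
  apply: subspace_continuous_measurable_fun => //.
  rewrite continuous_open_subspace// => x; rewrite inE/= in_itv/= => /andP[x0 _].
  exact: powR_mul_expRV_continuous.
have kA0 : 0 < k * A by rewrite mulr_gt0.
have al0 : 0 < alpha by lra.
have hf r : 0 < r -> f r <= (alpha / k) `^ alpha * A `^ (- alpha).
  move=> r0; have u0 : 0 < k * A / r by rewrite divr_gt0.
  have := @powR_mul_expRN_le R alpha _ al0 u0.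
  have powRV (x : R) : 0 < x -> x^-1 `^ alpha = (x `^ alpha)^-1.
    by move=> x0; rewrite -powR_inv1 ?ltW// -powRrM mulN1r powRN.
  rewrite !powRM ?invr_ge0 ?(ltW k0) ?(ltW A0) ?(ltW r0) ?(ltW al0) ?(ltW kA0)// !powRV// => h.
  rewrite /f !powRN ler_pdivlMr ?powR_gt0// ler_pdivlMr ?powR_gt0//.
  by apply: le_trans h; rewrite le_eqVlt; apply/orP; left; apply/eqP; ring.
(* Enlarging the interval beyond [A] treats [d <= A] and [A < d] together. *)
have step : (\int[lebesgue_measure]_(r in `]0%R, d[) (f r)%:E
    <= \int[lebesgue_measure]_(r in `]0%R, (A + d)%R[) (f r)%:E)%E.
  apply: ge0_subset_integral => //.
  - exact/measurable_EFinP.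
  - by move=> r _; rewrite lee_fin.
  - by apply: subset_itvl; rewrite bnd_simp; lra.
apply: (le_trans step).
have splitE : `]0, A + d[%classic = `]0, A]%classic `|` `]A, A + d[%classic :> set R.
  apply/seteqP; split => r /=; rewrite !in_itv/=.
    by move=> /andP[r0 rd]; case: (leP r A) => h; [left|right]; rewrite ?r0 ?h.
  by case=> /andP[h1 h2]; apply/andP; split; lra.
rewrite splitE ge0_integral_setU//; last first.
- rewrite disj_set2E; apply/eqP/seteqP; split => // r /=; rewrite !in_itv/=.
  by move=> [/andP[_ rA] /andP[Ar _]]; move: (lt_le_trans Ar rA); rewrite ltxx.
- by move=> r _; rewrite lee_fin.
- by rewrite -splitE; exact/measurable_EFinP.
rewrite mulrDl EFinD; apply: leeD.
  apply: (@le_trans _ _ (\int[lebesgue_measure]_(r in `]0%R, A])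
      ((alpha / k) `^ alpha * A `^ (- alpha))%:E)%E).
    apply: le_integral_pointwise => r; first by rewrite lee_fin.
    by rewrite /= in_itv/= => /andP[r0 _]; rewrite lee_fin hf.
  rewrite integral_cst//= lebesgue_measure_itv/= lte_fin A0 sube0 -EFinM lee_fin.
  have -> : A `^ (1 - alpha) = A * A `^ (- alpha).
    by rewrite powRD ?(gt_eqF A0) ?implybT// powRr1 ?(ltW A0).
  by rewrite -mulrA [A * _]mulrC.
have step2 : (\int[lebesgue_measure]_(r in `]A, (A + d)%R[) (f r)%:E
    <= \int[lebesgue_measure]_(r in `]A, (A + d)%R[) (r `^ (- alpha))%:E)%E.
  apply: le_integral_pointwise => r; first by rewrite lee_fin.
  rewrite /= in_itv/= => /andP[Ar _]; rewrite lee_fin ler_piMr ?powR_ge0//.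
  by rewrite expR_le1 oppr_le0 divr_ge0// ltW// (lt_trans A0).
apply: (le_trans step2); rewrite mulrC; apply: integral_powR_tail_le => //; lra.
Qed.

Lemma powR_sqr (R : realType) (w p : R) : (w ^+ 2) `^ p = `|w| `^ (2 * p).
Proof. by rewrite -[w ^+ 2]real_normK ?num_real// -powR_mulrn// -powRrM. Qed.

(** Below the exponent 1/2 the power alone is integrable at 0 and the factor in [w]
is 1.  Above it, integrability comes from the exponential, hence from [w != 0],
and [(w ^+ 2) `^ (2^-1 - beta)] is rescaled by [T]. *)
Lemma small_time_integral_le (R : realType) (beta : R) :
  beta != 2^-1 ->
  exists2 C : R, 0 <= C & forall T w d : R, 0 < T -> w != 0 \/ beta < 2^-1 ->
    0 < d -> d <= T ->
    (\int[lebesgue_measure]_(r in `]0%R, d[)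
        (r `^ (- (beta + 2^-1)) * expR (- (w ^+ 2 / 64 / r)))%:E
     <= (C * (T `^ (2^-1 - beta) * `|w / Num.sqrt T| `^ Num.min (1 - 2 * beta) 0))%:E)%E.
Proof.
move=> bN; have [b1|b1] := ltP beta 2^-1.
  exists (1 - (beta + 2^-1))^-1; first by rewrite invr_ge0; lra.
  move=> T w d T0 _ d0 dT.
  rewrite min_r ?subr_ge0; last lra.
  rewrite powRr0 mulr1.
  have step : (\int[lebesgue_measure]_(r in `]0%R, d[)
        (r `^ (- (beta + 2^-1)) * expR (- (w ^+ 2 / 64 / r)))%:E
      <= \int[lebesgue_measure]_(r in `]0%R, d[) (r `^ (- (beta + 2^-1)))%:E)%E.
    apply: le_integral_pointwise => r /=; rewrite in_itv/= => /andP[r0 _].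
      by rewrite lee_fin mulr_ge0 ?powR_ge0 ?expR_ge0.
    rewrite lee_fin ler_piMr ?powR_ge0// expR_le1 oppr_le0.
    by rewrite divr_ge0 ?(ltW r0)// divr_ge0 ?sqr_ge0.
  apply: (le_trans step).
  apply: (le_trans (integral_powR_0_le _ d0)); first lra.
  rewrite lee_fin mulrC ler_wpM2l ?invr_ge0; [|lra|].
    by lra.
  have -> : 1 - (beta + 2^-1) = 2^-1 - beta by lra.
  by apply: ge0_ler_powR; rewrite ?nnegrE; lra.
have {}b1 : 2^-1 < beta by rewrite lt_neqAle eq_sym bN.
exists ((((beta + 2^-1) / 64^-1) `^ (beta + 2^-1) + (beta + 2^-1 - 1)^-1)).
  by rewrite addr_ge0 ?powR_ge0// invr_ge0; lra.
move=> T w d T0 wb d0 dT.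
have w0 : w != 0 by case: wb => // ?; lra.
have w20 : 0 < w ^+ 2 by rewrite exprn_even_gt0.
under eq_integral do rewrite [_ / 64]mulrC.
apply: (le_trans (integral_powR_expRV_le _ _ w20 d0)); [lra|lra|].
rewrite lee_fin min_l; last lra.
rewrite le_eqVlt; apply/orP; left; apply/eqP; congr (_ * _).
have -> : 1 - (beta + 2^-1) = 2^-1 - beta by lra.
have -> : 1 - 2 * beta = 2 * (2^-1 - beta) by lra.
rewrite -powR_sqr expr_div_n sqr_sqrtr ?(ltW T0)//.
by rewrite -powRM ?divr_ge0 ?sqr_ge0 ?(ltW T0)// mulrC divfK// gt_eqF.
Qed.

(** * The density of the bridge *)

(** The exponents of the two transition densities minus the exponent of the
normalization: the squared distance to the linear interpolation of the endpoints,
divided by the variance of the bridge. *)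
Lemma bridge_exponentE (R : realType) (s r T a b : R) : 0 < s -> 0 < r -> r < T ->
  a ^+ 2 / (2 * s * r) + (b - a) ^+ 2 / (2 * s * (T - r)) - b ^+ 2 / (2 * s * T)
  = (T * a - r * b) ^+ 2 / (2 * s * r * (T - r) * T).
Proof.
move=> s0 r0 rT; field; rewrite !gt_eqF ?subr_gt0 ?(lt_trans r0 rT)//.
Qed.

Lemma bridge_exponent_ge0 (R : realType) (s r T a b : R) : 0 < s -> 0 < r -> r < T ->
  0 <= a ^+ 2 / (2 * s * r) + (b - a) ^+ 2 / (2 * s * (T - r)) - b ^+ 2 / (2 * s * T).
Proof.
move=> s0 r0 rT; rewrite bridge_exponentE// divr_ge0 ?sqr_ge0//.
by rewrite !mulr_ge0// ?(ltW s0) ?(ltW r0) ?subr_ge0 ?(ltW rT) ?(ltW (lt_trans r0 rT)).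
Qed.

(** From [(T a - r b)^2 >= (T a)^2 / 2 - (r b)^2] the exponent is at least
[a^2 / (4 s r) - r b^2 / (2 s T^2)].  As [s <= 2] and [4 a^2 >= w^2], the first
term is at least [w^2 / (32 r)]; one half of it is kept and the other half, like the
second term, is compared with its value at the largest time [eta * T / 64]. *)
Lemma bridge_exponent_small_time (R : realType) (s eta r T a b w : R) :
  1 <= s -> s <= 2 -> 0 < eta -> eta <= 1 -> 0 < r -> r <= eta * T / 64 ->
  w ^+ 2 <= 4 * a ^+ 2 ->
  w ^+ 2 / 64 / r + w ^+ 2 / (eta * T) - eta * (b ^+ 2 / T)
  <= a ^+ 2 / (2 * s * r) + (b - a) ^+ 2 / (2 * s * (T - r)) - b ^+ 2 / (2 * s * T).
Proof.
move=> s1 s2 eta0 eta1 r0 rT wa.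
have s0 : 0 < s by lra.
have T0 : 0 < T by nra.
have rT2 : r < T by nra.
rewrite bridge_exponentE//.
have step1 : (T * a - r * b) ^+ 2 / (2 * s * r * T * T)
    <= (T * a - r * b) ^+ 2 / (2 * s * r * (T - r) * T).
  apply: ler_wpM2l; first exact: sqr_ge0.
  rewrite lef_pV2 ?posrE; last 2 first.
  - by rewrite !mulr_gt0.
  - by rewrite !mulr_gt0// subr_gt0.
  rewrite ler_pM2r// ler_pM2l ?mulr_gt0//; lra.
apply: le_trans step1.
have step2 : a ^+ 2 / (4 * s * r) - r * b ^+ 2 / (2 * s * T * T)
    <= (T * a - r * b) ^+ 2 / (2 * s * r * T * T).
  rewrite -subr_ge0.
  have -> : (T * a - r * b) ^+ 2 / (2 * s * r * T * T)
      - (a ^+ 2 / (4 * s * r) - r * b ^+ 2 / (2 * s * T * T))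
      = (T * a - 2 * (r * b)) ^+ 2 / (4 * s * r * T * T).
    by field; rewrite !gt_eqF.
  by rewrite divr_ge0 ?sqr_ge0// !mulr_ge0// ltW.
apply: le_trans step2.
have h1 : w ^+ 2 / 32 / r <= a ^+ 2 / (4 * s * r).
  rewrite invfM mulrA ler_pM2r ?invr_gt0// ler_pdivlMr; nra.
have h2 : w ^+ 2 / (eta * T) <= w ^+ 2 / 64 / r.
  rewrite -mulrA -invfM ler_wpM2l ?sqr_ge0// lef_pV2 ?posrE ?mulr_gt0//; lra.
have h3 : r * b ^+ 2 / (2 * s * T * T) <= eta * (b ^+ 2 / T).
  rewrite mulrA invfM mulrA ler_pM2r ?invr_gt0// ler_pdivrMr ?mulr_gt0//.
  rewrite mulrAC ler_wpM2r ?sqr_ge0//; nra.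
lra.
Qed.

Lemma bm_densityE (R : realType) (sigma t u v : R) : 0 < sigma -> 0 < t ->
  bm_density sigma t u v
  = (sigma ^+ 2 * pi *+ 2) `^ (- 2^-1) * t `^ (- 2^-1)
    * expR (- ((v - u) ^+ 2 / (2 * sigma ^+ 2 * t))).
Proof.
move=> s0 t0.
have st0 : 0 < sigma * Num.sqrt t by rewrite mulr_gt0// sqrtr_gt0.
have c0 : 0 <= sigma ^+ 2 * pi *+ 2 by rewrite mulrn_wge0// mulr_ge0 ?sqr_ge0 ?pi_ge0.
rewrite /bm_density normal_pdfE ?gt_eqF// /normal_peak /normal_fun.
rewrite exprMn sqr_sqrtr ?(ltW t0)//; congr (_ * _).
  rewrite -powRM ?(ltW t0)// powRN powR12_sqrt ?mulr_ge0 ?(ltW t0)//.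
  by congr (Num.sqrt _)^-1; ring.
by congr expR; rewrite mulNr; congr (- (_ / _)); ring.
Qed.

(** The factor [(2 pi sigma^2)^(-1/2)] appears once more on the left than on the right
and is at most 1 when [sigma >= 1]. *)
Lemma bridge_density_le (R : realType) (sigma r T y v x e : R) :
  1 <= sigma -> 0 < r -> r < T ->
  e <= (v - y) ^+ 2 / (2 * sigma ^+ 2 * r)
     + ((x - y) - (v - y)) ^+ 2 / (2 * sigma ^+ 2 * (T - r))
     - (x - y) ^+ 2 / (2 * sigma ^+ 2 * T) ->
  bm_density sigma r y v * bm_density sigma (T - r) v x
  <= T `^ 2^-1 * r `^ (- 2^-1) * (T - r) `^ (- 2^-1) * expR (- e)
     * bm_density sigma T y x.
Proof.
move=> s1 r0 rT he.
have s0 : 0 < sigma by lra.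
have T0 : 0 < T by lra.
have Tr0 : 0 < T - r by lra.
rewrite !bm_densityE//.
set c := (_ *+ 2) `^ _.
have c1 : 0 <= c <= 1.
  rewrite powR_ge0/= /c powRN invf_le1 ?powR_gt0//; last first.
    by rewrite mulrn_wgt0// mulr_gt0 ?pi_gt0// exprn_gt0.
  have b1 : 1 <= sigma ^+ 2 * pi *+ 2.
    have p2 := @pi_ge2 R.
    have : 1 <= sigma ^+ 2 by rewrite exprn_ege1.
    nra.
  by have := ler_powR b1 (_ : 0 <= 2^-1); rewrite powRr0; apply; rewrite invr_ge0.
have -> : (x - v) ^+ 2 = ((x - y) - (v - y)) ^+ 2 by ring.
move: he; set A := (v - y) ^+ 2 / _; set B := _ ^+ 2 / (_ * (T - r)).
set D := (x - y) ^+ 2 / _ => he.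
have -> : c * r `^ (- 2^-1) * expR (- A) * (c * (T - r) `^ (- 2^-1) * expR (- B))
  = c * (r `^ (- 2^-1) * (T - r) `^ (- 2^-1)) * (c * expR (- (A + B))).
  by rewrite opprD expRD; ring.
have -> : T `^ 2^-1 * r `^ (- 2^-1) * (T - r) `^ (- 2^-1) * expR (- e)
  * (c * T `^ (- 2^-1) * expR (- D))
  = c * (r `^ (- 2^-1) * (T - r) `^ (- 2^-1)) * expR (- (e + D)).
  have : T `^ 2^-1 * T `^ (- 2^-1) = 1 by rewrite powRN divff// gt_eqF// powR_gt0.
  rewrite opprD expRD => h.
  transitivity ((T `^ 2^-1 * T `^ (- 2^-1)) * (c * (r `^ (- 2^-1) * (T - r) `^ (- 2^-1))
    * (expR (- e) * expR (- D)))); [ring|by rewrite h mul1r].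
case/andP: c1 => c0 c1.
apply: ler_wpM2l; first by rewrite !mulr_ge0 ?powR_ge0.
rewrite -[leRHS]mul1r; apply: ler_pM => //.
rewrite ler_expR; lra.
Qed.

(** Bayes' rule at the single time [r], with the density bounded on the window and the
positive density of the endpoint cancelled. *)
Lemma bridge_marginal_le (R : realType) (d : measure_display) (Omega : measurableType d)
    (P : probability Omega R) (B : R -> Omega -> R) (sigma T y x r z e K : R) :
  is_brownian_bridge P B sigma T y x -> 0 < sigma -> 0 < r -> r < T -> 0 < e ->
  (forall v, z <= v < z + e ->
    bm_density sigma r y v * bm_density sigma (T - r) v x
    <= K * bm_density sigma T y x) ->
  (P (B r @^-1` `[z, (z + e)%R[) <= (K * e)%:E)%E.
Proof.
move=> bB s0 r0 rT e0 hK.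
have T0 : 0 < T by exact: lt_trans rT.
have p0 : 0 < bm_density sigma T y x.
  rewrite bm_densityE// !mulr_gt0 ?expR_gt0 ?powR_gt0//.
  by rewrite mulrn_wgt0// mulr_gt0 ?exprn_gt0 ?pi_gt0.
have := bridge_fdd bB (l := [:: (r, `[z, z + e[%classic)]).
rewrite big_cons big_nil setIT /= r0 rT => /(_ isT) fdd.
have {}fdd : (P (B r @^-1` `[z, (z + e)%R[) * (bm_density sigma T y x)%:E =
    \int[lebesgue_measure]_(v in `[z, (z + e)%R[) ((bm_density sigma (r - 0) y v)%:E *
      (bm_density sigma (T - r) v x)%:E))%E.
  by apply: fdd => -[|i]//= _; exact: measurable_itv.
rewrite -(@lee_pmul2r _ (bm_density sigma T y x)%:E)// fdd subr0.
have le1 : (\int[lebesgue_measure]_(v in `[z, (z + e)%R[) ((bm_density sigma r y v)%:E *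
      (bm_density sigma (T - r) v x)%:E) <=
      \int[lebesgue_measure]_(v in `[z, (z + e)%R[) (K * bm_density sigma T y x)%:E)%E.
  apply: le_integral_pointwise => v /=; rewrite in_itv/= => /hK h.
    by rewrite -EFinM lee_fin mulr_ge0 ?normal_pdf_ge0.
  by rewrite -EFinM lee_fin.
apply: (le_trans le1).
rewrite integral_cst//= lebesgue_measure_itv/= lte_fin ltrDl e0 -EFinB -!EFinM lee_fin.
by rewrite addrC addKr mulrAC.
Qed.

(** * Stieltjes integrals against limits of distribution functions *)

Lemma lebesgue_stieltjes_measure_itvoc (R : realType) (L : cumulative R R) (a b : R) :
  a <= b -> lebesgue_stieltjes_measure L `]a, b] = (L b - L a)%:E.
Proof.
move=> ab; rewrite /lebesgue_stieltjes_measure /measure_extension measurable_mu_extE//=; last exact: is_ocitv.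
by rewrite wlength_itv_bnd.
Qed.

Lemma setU_itvoc (R : realType) (a b c : R) : a <= b -> b <= c ->
  `]a, c]%classic = `]a, b]%classic `|` `]b, c]%classic.
Proof.
move=> ab bc; apply/seteqP; split => r /=; rewrite !in_itv/=.
  by move=> /andP[ar rc]; case: (leP r b) => h; [left|right]; rewrite ?ar ?rc ?h.
case=> /andP[h1 h2]; apply/andP; split => //; first exact: le_trans bc.
exact: le_lt_trans ab h1.
Qed.

Lemma disjoint_itvoc (R : realType) (a b c : R) :
  [disjoint `]a, b]%classic & `]b, c]%classic].
Proof.
rewrite disj_set2E; apply/eqP/seteqP; split => // r /=; rewrite !in_itv/=.
by move=> [/andP[_ rb] /andP[br _]]; move: (lt_le_trans br rb); rewrite ltxx.
Qed.

(** The lower sum of [s `^ (- beta)] against the increments of [F] on the grid with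
nodes [T * q ^+ k]; on a geometric grid it differs from the upper sum exactly by the
factor [q `^ (- beta)]. *)
Definition geometric_sum (R : realType) (beta T q : R) (F : R -> R) (N : nat) : R :=
  \sum_(k < N) (T * q ^+ k) `^ (- beta) * (F (T * q ^+ k) - F (T * q ^+ k.+1)).

Section geometric_grid.
Context (R : realType) (beta T q : R).
Hypotheses (beta0 : 0 <= beta) (T0 : 0 < T) (q0 : 0 < q) (q1 : q < 1).

Let t_gt0 k : 0 < T * q ^+ k.
Proof. by rewrite mulr_gt0 ?exprn_gt0. Qed.

Let t_le k : T * q ^+ k.+1 <= T * q ^+ k.
Proof. by rewrite exprS mulrCA ler_piMl// ltW// t_gt0. Qed.

Let t_leT k : T * q ^+ k <= T.
Proof. by rewrite ler_piMr ?(ltW T0)// exprn_ile1 ?(ltW q0) ?(ltW q1). Qed.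

Let powRN_le (a b : R) : 0 < a -> a <= b -> b `^ (- beta) <= a `^ (- beta).
Proof.
move=> a0 ab; rewrite !powRN lef_pV2 ?posrE ?powR_gt0//; last exact: lt_le_trans ab.
by apply: ge0_ler_powR; rewrite ?nnegrE ?(ltW a0)// (le_trans (ltW a0)).
Qed.

Let mpow (D : set R) : measurable_fun D (fun s : R => (s `^ (- beta))%:E).
Proof. apply/measurable_EFinP; exact: measurable_funTS (measurable_powR _). Qed.

Lemma stieltjes_le_geometric_sum (L : cumulative R R) N :
  (\int[lebesgue_stieltjes_measure L]_(s in `](T * q ^+ N)%R, T]) (s `^ (- beta))%:E
    <= (q `^ (- beta) * geometric_sum beta T q L N)%:E)%E.
Proof.
elim: N => [|N ih].
  rewrite expr0 mulr1 set_itvoc0// integral_set0 /geometric_sum big_ord0 mulr0.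
  exact: lexx.
rewrite (@setU_itvoc _ _ (T * q ^+ N))// ge0_integral_setU//; last 3 first.
- exact: mpow.
- by move=> s _; rewrite lee_fin powR_ge0.
- exact: disjoint_itvoc.
rewrite /geometric_sum big_ord_recr/= mulrDr EFinD addeC; apply: leeD => //.
have step : (\int[lebesgue_stieltjes_measure L]_(s in `](T * q ^+ N.+1)%R, (T * q ^+ N)%R]) (s `^ (- beta))%:E
    <= \int[lebesgue_stieltjes_measure L]_(s in `](T * q ^+ N.+1)%R, (T * q ^+ N)%R]) ((T * q ^+ N.+1) `^ (- beta))%:E)%E.
  apply: le_integral_pointwise => s /=; rewrite in_itv/= lee_fin => /andP[h _].
    exact: powR_ge0.
  exact/powRN_le/ltW.
apply: (le_trans step); rewrite integral_cst//= lebesgue_stieltjes_measure_itvoc//.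
rewrite -EFinM lee_fin mulrA -powRM ?(ltW q0) ?(ltW (t_gt0 _))//.
by rewrite exprS mulrCA.
Qed.

Lemma geometric_sum_le_integral (g : R -> \bar R) (A : R -> R) N :
  measurable_fun (`]0, T] : set R) g -> (forall s, (0 <= g s)%E) ->
  (forall a b, 0 <= a -> a <= b -> b <= T ->
    (\int[lebesgue_measure]_(r in `]a, b]) g r = (A b - A a)%:E)%E) ->
  ((geometric_sum beta T q A N)%:E <=
    \int[lebesgue_measure]_(s in `](T * q ^+ N)%R, T]) ((s `^ (- beta))%:E * g s))%E.
Proof.
move=> mg g0 gA; elim: N => [|N ih].
  rewrite /geometric_sum big_ord0; apply: integral_ge0 => s _.
  by rewrite mule_ge0// lee_fin powR_ge0.
have mfg D : measurable D -> D `<=` `]0, T] ->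
    measurable_fun D (fun s : R => (s `^ (- beta))%:E * g s)%E.
  by move=> mD DT; apply: emeasurable_funM => //; exact: measurable_funS mg.
have sub N' : `](T * q ^+ N')%R, T] `<=` `]0, T].
  by apply: subset_itvr; rewrite bnd_simp ltW.
rewrite (@setU_itvoc _ _ (T * q ^+ N))// ge0_integral_setU//; last 3 first.
- by rewrite -setU_itvoc//; apply: mfg.
- by move=> s _; rewrite mule_ge0// lee_fin powR_ge0.
- exact: disjoint_itvoc.
rewrite /geometric_sum big_ord_recr/= EFinD addeC; apply: leeD => //.
rewrite EFinM -gA//; last exact/ltW.
have c0 : (0 <= ((T * q ^+ N) `^ (- beta))%:E)%E by rewrite lee_fin powR_ge0.
have mgN : measurable_fun (`]T * q ^+ N.+1, T * q ^+ N] : set R) g.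
  by apply: measurable_funS mg => //; apply: subset_itv; rewrite bnd_simp// ltW.
rewrite -(ge0_integralZl lebesgue_measure (measurable_itv _) mgN (fun s _ => g0 s) c0).
apply: le_integral_pointwise => s /=; rewrite in_itv/= => /andP[h1 h2].
  by rewrite mule_ge0// lee_fin powR_ge0.
apply: lee_wpmul2r => //; rewrite lee_fin; apply: powRN_le => //.
exact: lt_trans h1.
Qed.

End geometric_grid.

Lemma bigcup_geometric_itvoc (R : realType) (T q : R) : 0 < T -> 0 < q -> q < 1 ->
  \bigcup_N `]T * q ^+ N, T]%classic = `]0, T]%classic.
Proof.
move=> T0 q0 q1; apply/seteqP; split => [s [N _]|s] /=; rewrite !in_itv/=.
  move=> /andP[h ->]; rewrite andbT; apply: lt_trans h.
  by rewrite mulr_gt0 ?exprn_gt0.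
move=> /andP[s0 sT].
have /cvg_geometric : `|q| < 1 by rewrite ger0_norm ?(ltW q0).
move=> /(_ T)/cvgrPdist_lt/(_ s s0)[N _ /(_ N (leqnn N))] /=.
rewrite sub0r normrN ger0_norm ?mulr_ge0 ?exprn_ge0 ?(ltW T0) ?(ltW q0)// => h.
by exists N => //=; rewrite in_itv/= h.
Qed.

(** For a fixed ratio [q], the lower sums involve finitely many values of [A n], and so
converge; they give the inequality up to the factor [q `^ (- beta)], first on
[`]T * q ^+ N, T]], then on [`]0, T]] by exhaustion.  Letting [q] tend to 1 removes
the factor. *)
Lemma stieltjes_le_limn_einf (R : realType) (beta T : R) (L : cumulative R R)
    (g : nat -> R -> \bar R) (A : nat -> R -> R) :
  0 <= beta -> 0 < T ->
  (forall n, measurable_fun (`]0, T] : set R) (g n)) ->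
  (forall n s, (0 <= g n s)%E) ->
  (forall n a b, 0 <= a -> a <= b -> b <= T ->
    (\int[lebesgue_measure]_(r in `]a, b]) g n r = (A n b - A n a)%:E)%E) ->
  (forall t, 0 <= t <= T -> A n t @[n --> \oo] --> L t) ->
  (\int[lebesgue_stieltjes_measure L]_(s in `]0%R, T]) (s `^ (- beta))%:E
   <= limn_einf (fun n =>
        \int[lebesgue_measure]_(s in `]0%R, T]) ((s `^ (- beta))%:E * g n s)))%E.
Proof.
move=> beta0 T0 mg g0 gA AL.
apply/lee_mul01Pr.
  by apply: integral_ge0 => s _; rewrite lee_fin powR_ge0.
move=> r /andP[r0 r1]; set l := limn_einf _.
(* The exponent keeps [q < 1] when [beta = 0] and still gives [r <= q `^ beta]. *)
pose q := r `^ (beta + 1)^-1.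
have b1 : 0 < beta + 1 by rewrite ltr_wpDl.
have q0 : 0 < q by rewrite powR_gt0.
have q1 : q < 1.
  have := @gt0_ltr_powR R (beta + 1)^-1 _ r 1; rewrite powR1; apply => //.
  - by rewrite invr_gt0.
  - by rewrite nnegrE ltW.
  - by rewrite nnegrE.
have rq : r <= q `^ beta.
  rewrite /q -powRrM -[leLHS](powRr1 (ltW r0)) ger_powR ?r0 ?(ltW r1)//.
  by rewrite mulrC ler_pdivrMr// mul1r lerDl.
have le1 : (\int[lebesgue_stieltjes_measure L]_(s in `]0%R, T]) (s `^ (- beta))%:E
    <= (q `^ (- beta))%:E * l)%E.
  rewrite -(@bigcup_geometric_itvoc _ T q)//; apply: integral_le_exhaust => //.
  - apply/nondecreasing_seqP => n; apply/subsetPset; apply: subset_itvr.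
    by rewrite bnd_simp exprS mulrCA ler_piMl ?(ltW q1)// mulr_ge0 ?exprn_ge0 ?(ltW T0) ?(ltW q0).
  - by apply/measurable_EFinP; exact: measurable_funTS (measurable_powR _).
  - by move=> s _; rewrite lee_fin powR_ge0.
  move=> N; apply: (le_trans (stieltjes_le_geometric_sum beta0 T0 q0 q1 L N)).
  rewrite EFinM; apply: lee_wpmul2l; first by rewrite lee_fin powR_ge0.
  apply: (@le_limn_einf_cvg _ (fun n => (geometric_sum beta T q (A n) N)%:E)).
    apply/cvg_EFin; first exact: nearW.
    apply: cvg_big => [|k _]; first exact: add_continuous.
    have tk j : 0 <= T * q ^+ j <= T.
      by rewrite mulr_ge0 ?exprn_ge0 ?(ltW T0) ?(ltW q0)//= ler_piMr ?(ltW T0)// exprn_ile1 ?(ltW q0) ?(ltW q1).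
    by apply: cvgM; [exact: cvg_cst|apply: cvgB; exact/AL/tk].
  move=> n; apply: (le_trans (geometric_sum_le_integral beta0 T0 q0 q1 N (mg n) (g0 n) (gA n))).
  apply: ge0_subset_integral => //.
  - apply: emeasurable_funM; last exact: mg.
    by apply/measurable_EFinP; exact: measurable_funTS (measurable_powR _).
  - by move=> s _; rewrite mule_ge0// lee_fin powR_ge0.
  - by apply: subset_itvr; rewrite bnd_simp mulr_ge0 ?exprn_ge0 ?(ltW T0) ?(ltW q0).
have qq : (q `^ beta * q `^ (- beta) = 1) by rewrite powRN divff// gt_eqF// powR_gt0.
have : ((q `^ beta)%:E * \int[lebesgue_stieltjes_measure L]_(s in `]0%R, T]) (s `^ (- beta))%:E <= l)%E.
  rewrite -[leRHS]mul1e -qq EFinM -muleA.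
  by apply: lee_wpmul2l => //; rewrite lee_fin powR_ge0.
apply: le_trans; apply: lee_wpmul2r; last by rewrite lee_fin.
by apply: integral_ge0 => s _; rewrite lee_fin powR_ge0.
Qed.

(** * Occupation measures of the bridge *)

Lemma grid_cell (R : realType) (T r : R) (n : nat) : 0 < T -> 0 <= r <= T ->
  exists2 k : 'I_n.+2, T / n.+1%:R * k%:R <= r < T / n.+1%:R * k.+1%:R &
    forall j : 'I_n.+2, T / n.+1%:R * j%:R <= r < T / n.+1%:R * j.+1%:R -> j = k.
Proof.
move=> T0 /andP[r0 rT].
have h0 : 0 < T / n.+1%:R by rewrite divr_gt0.
set h := T / _ in h0 *.
pose m := Num.trunc (r / h).
have /andP[m1 m2] : m%:R <= r / h < m.+1%:R by apply: trunc_itv; rewrite divr_ge0// ltW.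
have mn : (m < n.+2)%N.
  rewrite -(ltr_nat R); apply: le_lt_trans m1 _.
  apply: (@le_lt_trans _ _ n.+1%:R); last by rewrite ltr_nat.
  by rewrite ler_pdivrMr// /h mulrC divfK ?pnatr_eq0.
exists (Ordinal mn) => /=.
  by rewrite mulrC -ler_pdivlMr// m1/= mulrC -ltr_pdivrMr.
move=> j /andP[j1 j2]; apply: val_inj => /=.
have jm : (j < m.+1)%N.
  by rewrite -(ltr_nat R); apply: le_lt_trans m2; rewrite ler_pdivlMr// mulrC.
have mj : (m < j.+1)%N.
  by rewrite -(ltr_nat R); apply: le_lt_trans m1 _; rewrite ltr_pdivrMr// mulrC.
by apply/eqP; rewrite eqn_leq -ltnS jm -ltnS mj.
Qed.

(** A process with continuous paths is the pointwise limit of the processes frozen at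
the left endpoints of regular grids, and these are finite sums of products of a
function of time and a function of the path. *)
Lemma measurable_uncurry_continuous (R : realType) (d : measure_display)
    (Omega : measurableType d) (B : R -> Omega -> R) (T : R) (E : set Omega) :
  0 < T -> measurable E ->
  (forall t, t \in `[0, T] -> measurable_fun setT (B t)) ->
  (forall w, E w -> {within `[0, T], continuous (fun t => B t w)}) ->
  measurable_fun (`[0, T]%classic `*` E) (fun p : R * Omega => B p.1 p.2).
Proof.
move=> T0 mE mB cB.
pose h (n : nat) : R := T / n.+1%:R.
pose c n (k : nat) : set R := `[h n * k%:R, h n * k.+1%:R[%classic.
pose S n (p : R * Omega) : R :=
  \sum_(k < n.+2) \1_(c n k) p.1 * B (h n * k%:R) p.2.
have h0 n : 0 < h n by rewrite divr_gt0.
have gridT n (k : 'I_n.+2) : h n * k%:R \in `[0, T].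
  rewrite in_itv/= mulr_ge0 ?(ltW (h0 n))//=.
  rewrite /h -mulrA ger_pMr// mulrC ler_pdivrMr// mul1r ler_nat.
  by rewrite -ltnS.
have mS n : measurable_fun setT (S n).
  apply: measurable_sum => k; apply: measurable_funM.
    apply: (@measurableT_comp _ _ _ _ _ _ (\1_(c n k) : R -> R) _ (@fst R Omega)) => //.
    by apply: measurable_indic; exact: measurable_itv.
  by apply: (@measurableT_comp _ _ _ _ _ _ (B (h n * k%:R)) _ (@snd R Omega)) => //; exact/mB/gridT.
apply: (@measurable_fun_cvg _ _ _ _ S); first by move=> n; exact: measurable_funTS.
move=> [r w] [/= rT Ew].
have rT' : 0 <= r <= T by move: rT; rewrite /= in_itv.
have /subspace_continuousP/(_ r rT)/cvgrPdist_lt cw := cB w Ew.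
apply/cvgrPdist_lt => e e0.
have /nbhs_ballP[dl /= dl0 hdl] := cw e e0.
have hn0 : h n @[n --> \oo] --> 0.
  rewrite -(mulr0 T); apply: cvgM; [exact: cvg_cst|exact: cvg_harmonic].
have /cvgrPdist_lt/(_ dl dl0) := hn0.
apply: filterS => n; rewrite sub0r normrN ger0_norm ?ltW// => hdn.
have [k hk uk] := grid_cell n T0 rT'.
have -> : S n (r, w) = B (h n * k%:R) w.
  rewrite /S (bigD1 k)//= big1 ?addr0 => [|j jk].
    by rewrite indicE mem_set ?mul1r//= /c/= in_itv.
  rewrite indicE memNset ?mul0r//= /c/= in_itv/= => /uk jk'.
  by rewrite jk' eqxx in jk.
apply: hdl; last exact: gridT.
rewrite /ball/= ger0_norm; move/andP: hk => [k1 k2]; last by rewrite subr_ge0.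
apply: lt_trans hdn; rewrite ltrBlDl; apply: lt_le_trans k2 _.
by rewrite -(natr1 k) mulrDr mulr1.
Qed.

Lemma fubini_restrict_l (R : realType) (d : measure_display) (Omega : measurableType d)
    (P : probability Omega R) (D : set R) (f : R * Omega -> \bar R) :
  measurable D -> measurable_fun setT f -> (forall p, (0 <= f p)%E) ->
  measurable_fun setT (fun w => \int[lebesgue_measure]_(s in D) f (s, w))%E /\
  measurable_fun setT (fun s => \int[P]_w f (s, w))%E /\
  (\int[P]_w \int[lebesgue_measure]_(s in D) f (s, w) =
   \int[lebesgue_measure]_(s in D) \int[P]_w f (s, w))%E.
Proof.
move=> mD mf f0.
pose h (p : R * Omega) : \bar R := ((\1_D p.1)%:E * f p)%E.
have mh : measurable_fun setT h.
  apply: emeasurable_funM => //; apply/measurable_EFinP.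
  apply: (@measurableT_comp _ _ _ _ _ _ (\1_D : R -> R) _ (@fst R Omega)) => //.
have h0 p : (0 <= h p)%E by rewrite mule_ge0// lee_fin.
have E1 w : (\int[lebesgue_measure]_(s in D) f (s, w) = \int[lebesgue_measure]_s h (s, w))%E.
  rewrite integral_mkcond; apply: eq_integral => s _.
  by rewrite patchE /h/= indicE; case: ifPn => _; rewrite ?mul1e ?mul0e.
have E2 : (\int[lebesgue_measure]_(s in D) \int[P]_w f (s, w)
   = \int[lebesgue_measure]_s \int[P]_w h (s, w))%E.
  rewrite integral_mkcond; apply: eq_integral => s _.
  rewrite patchE /h/= indicE; case: ifPn => _.
    by apply: eq_integral => w _; rewrite mul1e.
  by rewrite integral0_eq// => w _; rewrite mul0e.
split; [|split].
- under eq_fun do rewrite E1.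
  exact: (@measurable_fun_fubini_tonelli_G _ _ _ _ _ lebesgue_measure h mh h0).
- exact: (@measurable_fun_fubini_tonelli_F _ _ _ _ _ P f mf f0).
- under eq_integral do rewrite E1.
  rewrite E2.
  by rewrite (@fubini_tonelli _ _ _ _ _ lebesgue_measure P h mh h0).
Qed.

(** Paths are restricted to a set [E] on which they will be continuous: this is what
makes the set measurable in the product. *)
Definition hitting_graph (R : realType) (Omega : Type) (B : R -> Omega -> R)
    (T : R) (E : set Omega) (z e : R) : set (R * Omega) :=
  (`]0, T]%classic `*` E) `&` ((fun p => B p.1 p.2) @^-1` `[z, z + e[%classic).

Lemma measurable_hitting_graph (R : realType) (d : measure_display)
    (Omega : measurableType d) (B : R -> Omega -> R) (T : R) (E : set Omega) (z e : R) :
  0 < T -> measurable E ->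
  (forall t, t \in `[0, T] -> measurable_fun setT (B t)) ->
  (forall w, E w -> {within `[0, T], continuous (fun t => B t w)}) ->
  measurable (hitting_graph B T E z e).
Proof.
move=> T0 mE mB cB.
have mD : measurable (`]0, T]%classic `*` E) by exact: measurableX.
apply: (measurable_funS _ _ (measurable_uncurry_continuous T0 mE mB cB)) => //.
  exact: measurableX.
by move=> [s w] [/= sT Ew]; split => //=; move: sT; apply: subset_itv_oc_cc.
Qed.

(** The estimate of the theorem for the occupation measure of the window [[z, z + e)]
in place of the local time, with a constant that does not depend on [e]. *)
Lemma bridge_weighted_occupation_le (R : realType) (beta eta : R) :
  0 <= beta -> beta != 2^-1 -> 0 < eta -> eta <= 1 ->
  exists C : R, forall (T x y z e : R), 0 < T -> y != z \/ beta < 2^-1 -> 0 < e ->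
    y = z \/ e <= `|y - z| / 2 ->
    forall (d : measure_display) (Omega : measurableType d)
      (P : probability Omega R) (B : R -> Omega -> R) (E : set Omega),
    is_brownian_bridge P B (Num.sqrt (1 + eta)) T y x -> measurable E ->
    (forall w, E w -> {within `[0, T], continuous (fun t => B t w)}) ->
    (\int[P]_w \int[lebesgue_measure]_(s in `]0%R, T])
        ((s `^ (- beta))%:E * ((1 + eta) / e * \1_(hitting_graph B T E z e) (s, w))%:E)
     <= (C * T `^ (2^-1 - beta) *
          (1 + `|(y - z) / Num.sqrt T| `^ Num.min (1 - 2 * beta) 0 *
               expR (- ((y - z) ^+ 2 / (eta * T))) *
               expR (eta * ((x - y) ^+ 2 / T))))%:E)%E.
Proof.
move=> beta0 bN eta0 eta1.
have [Cs Cs0 hCs] := small_time_integral_le bN.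
pose alpha := beta + 2^-1.
pose c2 : R := 4 * (eta / 64) `^ (- alpha).
exists (4 * Cs + c2) => T x y z e T0 yz e0 he d Omega P B E bB mE cB.
set sigma := Num.sqrt (1 + eta).
have sigma1 : 1 <= sigma by rewrite -sqrtr1 ler_wsqrtr; lra.
have sigma2 : sigma ^+ 2 = 1 + eta by rewrite sqr_sqrtr; lra.
have sigma0 : 0 < sigma by lra.
pose w0 := y - z; pose b := x - y.
pose A := hitting_graph B T E z e.
have mB := bridge_measurable bB.
have mA : measurable A by exact: measurable_hitting_graph.
pose f (p : R * Omega) : \bar R :=
  ((p.1 `^ (- beta))%:E * ((1 + eta) / e * \1_A p)%:E)%E.
have c0 : 0 <= (1 + eta) / e by rewrite divr_ge0 ?(ltW e0)//; lra.
have f0 p : (0 <= f p)%E.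
  by rewrite mule_ge0// lee_fin ?powR_ge0// mulr_ge0.
have mf : measurable_fun setT f.
  apply: emeasurable_funM; apply/measurable_EFinP.
    apply: (@measurableT_comp _ _ _ _ _ _ (fun s : R => s `^ (- beta)) _ (@fst R Omega)) => //.
  by apply: measurable_funM => //; exact: measurable_indic.
have [_ [mG fub]] := fubini_restrict_l P (measurable_itv `]0, T]) mf f0.
pose G s : \bar R := (\int[P]_w f (s, w))%E.
have G0 s : (0 <= G s)%E by apply: integral_ge0.
have -> : (\int[P]_w \int[lebesgue_measure]_(s in `]0%R, T])
        ((s `^ (- beta))%:E * ((1 + eta) / e * \1_A (s, w))%:E)
   = \int[lebesgue_measure]_(s in `]0%R, T[) G s)%E.
  by rewrite fub -integral_itv_bndo_bndc//; exact: measurable_funTS mG.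
(* The width [e] of the window cancels against the normalization of [G]. *)
have GK s K : 0 < s -> s < T ->
    (forall v, z <= v < z + e -> bm_density sigma s y v * bm_density sigma (T - s) v x
      <= K * bm_density sigma T y x) ->
    (G s <= (2 * s `^ (- beta) * K)%:E)%E.
  move=> s0 sT hK.
  have hP := bridge_marginal_le bB sigma0 s0 sT e0 hK.
  have s0T : s \in `[0, T] by rewrite in_itv/= !ltW.
  have mI : measurable (B s @^-1` `[z, z + e[%classic).
    by rewrite -[X in measurable X]setTI; apply: mB.
  have K0 : 0 <= K * e.
    by rewrite -lee_fin; apply: le_trans hP.
  have le1 : (G s <= \int[P]_w ((s `^ (- beta) * ((1 + eta) / e))%:E *
      (\1_(B s @^-1` `[z, z + e[%classic) w)%:E))%E.
    apply: le_integral_pointwise => w _; first exact: f0.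
    rewrite /f/= -!EFinM lee_fin -[leRHS]mulrA; apply: ler_wpM2l; first exact: powR_ge0.
    apply: ler_wpM2l => //.
    rewrite !indicE ler_nat; case: (boolP (_ \in A)) => // /set_mem[_ /= h].
    by rewrite mem_set.
  apply: (le_trans le1).
  rewrite ge0_integralZl//; last 2 first.
  - by apply/measurable_EFinP; exact: measurable_indic.
  - by rewrite lee_fin mulr_ge0 ?powR_ge0.
  rewrite integral_indic// setIT.
  apply: (@le_trans _ _ ((s `^ (- beta) * ((1 + eta) / e))%:E * (K * e)%:E)%E).
    by apply: lee_wpmul2l => //; rewrite lee_fin mulr_ge0 ?powR_ge0.
  rewrite -EFinM lee_fin.
  have -> : s `^ (- beta) * ((1 + eta) / e) * (K * e) = (1 + eta) * (s `^ (- beta) * K).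
    by field; rewrite gt_eqF.
  rewrite -[leRHS]mulrA; apply: ler_wpM2r; last lra.
  by rewrite mulr_ge0 ?powR_ge0//; move: K0; rewrite pmulr_lge0.
pose dl := eta * T / 64.
have dl0 : 0 < dl by rewrite /dl divr_gt0// mulr_gt0.
have dlT : dl <= T / 2 by rewrite /dl; nra.
have splitE : `]0, T[%classic = `]0, dl[%classic `|` `[dl, T[%classic :> set R.
  apply/seteqP; split => r /=; rewrite !in_itv/=.
    by move=> /andP[r0 rT]; case: (ltP r dl) => h; [left|right]; rewrite ?r0 ?rT ?h.
  by case=> /andP[h1 h2]; apply/andP; split; lra.
rewrite splitE ge0_integral_setU//; last 2 first.
- exact: measurable_funTS mG.
- rewrite disj_set2E; apply/eqP/seteqP; split => // r /=; rewrite !in_itv/=.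
  by move=> [/andP[_ rA] /andP[Ar _]]; move: (lt_le_trans rA Ar); rewrite ltxx.
pose W := `|(y - z) / Num.sqrt T| `^ Num.min (1 - 2 * beta) 0.
pose Eb := expR (- ((y - z) ^+ 2 / (eta * T))) * expR (eta * ((x - y) ^+ 2 / T)).
(* Halving the distance to [y] is the price for a whole window of levels. *)
have sep v : z <= v < z + e -> (y - z) ^+ 2 <= 4 * (v - y) ^+ 2.
  move=> /andP[zv ve]; case: he => [->|he']; first by rewrite subrr expr0n/= mulr_ge0 ?sqr_ge0.
  have [h|h] := leP z y.
    rewrite ger0_norm ?subr_ge0// in he'.
    have : 0 <= (y - z) / 2 <= y - v by apply/andP; split; lra.
    by move=> /andP[? ?]; nra.
  have : 0 <= z - y <= v - y by apply/andP; split; lra.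
  by move=> /andP[? ?]; nra.
have near_le : (\int[lebesgue_measure]_(s in `]0%R, dl[) G s <=
    (4 * Cs * T `^ (2^-1 - beta) * (W * Eb))%:E)%E.
  have le1 : (\int[lebesgue_measure]_(s in `]0%R, dl[) G s <=
      \int[lebesgue_measure]_(s in `]0%R, dl[)
        ((4 * Eb)%:E * (s `^ (- alpha) * expR (- ((y - z) ^+ 2 / 64 / s)))%:E))%E.
    apply: le_integral_pointwise => s /=; rewrite in_itv/= => /andP[s0 sdl]; first exact: G0.
    have sT : s < T by lra.
    apply: (le_trans (GK s _ s0 sT _)).
      move=> v /sep hv; apply: bridge_density_le => //; rewrite sigma2.
      by apply: (@bridge_exponent_small_time _ _ eta _ _ (v - y) (x - y) (y - z)) => //; rewrite -/dl; lra.
    rewrite -EFinM lee_fin.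
    have hsq : T `^ 2^-1 * (T - s) `^ (- 2^-1) <= 2.
      have Ts : 0 < T - s by lra.
      rewrite powRN ler_pdivrMr ?powR_gt0// !powR12_sqrt ?(ltW T0) ?(ltW Ts)//.
      have -> : 2 = Num.sqrt 4 :> R by rewrite (_ : 4 = 2 ^+ 2) ?sqrtr_sqr ?ger0_norm//; ring.
      by rewrite -sqrtrM// ler_wsqrtr; lra.
    have -> : s `^ (- alpha) = s `^ (- beta) * s `^ (- 2^-1).
      by rewrite -powRD ?(gt_eqF s0) ?implybT// /alpha opprD.
    have -> : expR (- ((y - z) ^+ 2 / 64 / s + (y - z) ^+ 2 / (eta * T) - eta * ((x - y) ^+ 2 / T)))
        = expR (- ((y - z) ^+ 2 / 64 / s)) * Eb.
      by rewrite /Eb -!expRD; congr expR; ring.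
    set Y := expR (- _).
    have -> : 2 * s `^ (- beta) * (T `^ 2^-1 * s `^ (- 2^-1) * (T - s) `^ (- 2^-1) * (Y * Eb))
      = (2 * s `^ (- beta) * s `^ (- 2^-1) * (Y * Eb)) * (T `^ 2^-1 * (T - s) `^ (- 2^-1)) by ring.
    have -> : 4 * Eb * (s `^ (- beta) * s `^ (- 2^-1) * Y)
      = (2 * s `^ (- beta) * s `^ (- 2^-1) * (Y * Eb)) * 2 by ring.
    by apply: ler_wpM2l hsq; rewrite !mulr_ge0 ?powR_ge0 ?expR_ge0.
  apply: (le_trans le1); rewrite ge0_integralZl//; last 3 first.
  - apply/measurable_EFinP; apply: subspace_continuous_measurable_fun => //.
    rewrite continuous_open_subspace// => s; rewrite inE/= in_itv/= => /andP[s0 _].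
    exact: powR_mul_expRV_continuous.
  - by move=> s _; rewrite lee_fin mulr_ge0 ?powR_ge0 ?expR_ge0.
  - by rewrite lee_fin !mulr_ge0 ?expR_ge0.
  have yz' : y - z != 0 \/ beta < 2^-1 by rewrite subr_eq0.
  apply: le_trans (lee_wpmul2l _ (hCs T (y - z) dl T0 yz' dl0 _)) _.
  - by rewrite lee_fin !mulr_ge0 ?expR_ge0.
  - lra.
  rewrite -EFinM lee_fin -/W le_eqVlt; apply/orP; left; apply/eqP; ring.
have far_le : (\int[lebesgue_measure]_(s in `[dl, T[) G s <=
    (c2 * T `^ (2^-1 - beta))%:E)%E.
  have T20 : 0 <= 2 * T `^ 2^-1 * dl `^ (- alpha) by rewrite !mulr_ge0 ?powR_ge0.
  have le1 : (\int[lebesgue_measure]_(s in `[dl, T[) G s <=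
      \int[lebesgue_measure]_(s in `[dl, T[)
        ((2 * T `^ 2^-1 * dl `^ (- alpha))%:E * ((T - s) `^ (- 2^-1))%:E))%E.
    apply: le_integral_pointwise => s /=; rewrite in_itv/= => /andP[sdl sT]; first exact: G0.
    have s0 : 0 < s by lra.
    apply: (le_trans (GK s _ s0 sT _)).
      move=> v _; apply: (@bridge_density_le _ _ _ _ _ _ _ 0) => //.
      by apply: bridge_exponent_ge0 => //; rewrite sigma2; lra.
    rewrite -EFinM lee_fin oppr0 expR0 mulr1.
    have -> : 2 * s `^ (- beta) * (T `^ 2^-1 * s `^ (- 2^-1) * (T - s) `^ (- 2^-1))
      = (2 * T `^ 2^-1) * (s `^ (- beta) * s `^ (- 2^-1)) * (T - s) `^ (- 2^-1) by ring.
    rewrite -powRD ?(gt_eqF s0) ?implybT// -opprD -/alpha.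
    apply: ler_wpM2r; first exact: powR_ge0.
    apply: ler_wpM2l; first by rewrite mulr_ge0 ?powR_ge0.
    rewrite !powRN lef_pV2 ?posrE ?powR_gt0//.
    by apply: ge0_ler_powR; rewrite ?nnegrE /alpha; lra.
  have mr (D : set R) : measurable D -> measurable_fun D (fun s : R => ((T - s) `^ (- 2^-1))%:E).
    move=> mD; apply/measurable_EFinP; apply: measurable_funTS.
    apply: (@measurableT_comp _ _ _ _ _ _ (fun s : R => s `^ (- 2^-1))) => //.
    exact: measurable_funB.
  apply: (le_trans le1); rewrite ge0_integralZl//; last 2 first.
  - exact: mr.
  - by move=> s _; rewrite lee_fin powR_ge0.
  apply: (@le_trans _ _ ((2 * T `^ 2^-1 * dl `^ (- alpha))%:E * (2 * T `^ 2^-1)%:E)%E).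
    apply: lee_wpmul2l; first by rewrite lee_fin.
    apply: (le_trans _ (integral_powR_right_le (lexx 0) T0)).
    apply: ge0_subset_integral => //.
    - exact: mr.
    - by move=> s _; rewrite lee_fin powR_ge0.
    - by apply: subset_itvr; rewrite bnd_simp.
  rewrite -EFinM lee_fin le_eqVlt; apply/orP; left; apply/eqP.
  have TT : T `^ 2^-1 * T `^ 2^-1 = T.
    rewrite -powRD ?(gt_eqF T0) ?implybT// (_ : 2^-1 + 2^-1 = 1); last lra.
    by rewrite powRr1 ?ltW.
  have -> : dl `^ (- alpha) = (eta / 64) `^ (- alpha) * T `^ (- alpha).
    by rewrite -powRM ?divr_ge0 ?(ltW T0) ?(ltW eta0)// /dl mulrAC.
  have -> : T `^ (2^-1 - beta) = T * T `^ (- alpha).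
    rewrite -[X in _ = X * _](powRr1 (ltW T0)) -powRD ?(gt_eqF T0) ?implybT//.
    by congr (_ `^ _); rewrite /alpha; lra.
  transitivity (c2 * (T `^ 2^-1 * T `^ 2^-1 * T `^ (- alpha))); last by rewrite TT.
  by rewrite /c2; ring.
apply: (le_trans (leeD near_le far_le)).
rewrite -EFinD lee_fin -/W -[W * _ * _]mulrA -/Eb.
have := powR_ge0 T (2^-1 - beta); set X := T `^ _ => X0.
have WE0 : 0 <= W * Eb by rewrite mulr_ge0 ?powR_ge0// mulr_ge0 ?expR_ge0.
have c20 : 0 <= c2 by rewrite mulr_ge0 ?powR_ge0.
have : 0 <= 4 * Cs * X by rewrite !mulr_ge0.
have : 0 <= c2 * X * (W * Eb) by rewrite !mulr_ge0 ?expR_ge0 ?powR_ge0.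
lra.
Qed.

(** * The local time *)

(** The approximations of the local time are the distribution functions of the
occupation measures. *)
Lemma occupation_increment (R : realType) (T a b c e z : R) (phi : R -> R) :
  0 <= a -> a <= b -> b <= T -> measurable_fun (`[0, T] : set R) phi ->
  (\int[lebesgue_measure]_(s in `]a, b]) (c / e * \1_(`[z, z + e[) (phi s))%:E =
   (e^-1 * (\int[lebesgue_measure]_(s in `[0%R, b]) (\1_(`[z, (z + e)%R[) (phi s) * c))%R
    - e^-1 * (\int[lebesgue_measure]_(s in `[0%R, a]) (\1_(`[z, (z + e)%R[) (phi s) * c))%R)%:E)%E.
Proof.
move=> a0 ab bT mphi.
pose h s : R := \1_(`[z, z + e[) (phi s) * c.
have mh (D : set R) : measurable D -> D `<=` `[0, T] -> measurable_fun D h.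
  move=> mD DT; apply: measurable_funM => //.
  apply: (@measurable_comp _ _ _ _ _ _ setT (\1_(`[z, z + e[%classic) : R -> R) D phi) => //.
  exact: measurable_funS mphi.
have ih (D : set R) : measurable D -> D `<=` `[0, T] ->
    lebesgue_measure.-integrable D (EFin \o h).
  move=> mD DT; apply: measurable_bounded_integrable => //.
  - apply: (@le_lt_trans _ _ (lebesgue_measure (`[0, T]%classic : set R))).
      by apply: le_measure; rewrite ?inE//; exact: measurable_itv.
    by rewrite lebesgue_measure_itv/=; case: ifP => _; rewrite ?ltry.
  - exact: mh.
  - exists `|c|; split; first exact: num_real.
    move=> M cM s _; rewrite /= /h normrM (le_trans _ (ltW cM))// ler_piMl//.
    by rewrite indicE; case: (_ \in _); rewrite ?normr1 ?normr0.
rewrite -mulrBr Rintegral_itvB ?bnd_simp//; last by apply: ih => //; apply: subset_itvl; rewrite bnd_simp.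
have sub : (`]a, b]%classic : set R) `<=` `[0, T]%classic.
  by move=> s /=; rewrite !in_itv/= => /andP[h1 h2]; apply/andP; split; lra.
have iab := ih _ (measurable_itv `]a, b]) sub.
rewrite EFinM /Rintegral fineK; last exact: integrable_fin_num.
rewrite -integralZl//; apply: eq_integral => s _.
by rewrite /= -EFinM; congr (_%:E); ring.
Qed.

Lemma eta_gt0_le1 (R : realType) (eta : R) :
  1 < Num.sqrt (1 + eta) <= Num.sqrt 2 -> 0 < eta /\ eta <= 1.
Proof.
move=> /andP[h1 h2]; split.
  rewrite ltNge; apply/negP => e0; move: h1; apply/negP; rewrite -leNgt.
  by rewrite -[leRHS]sqrtr1 ler_wsqrtr//; lra.
rewrite leNgt; apply/negP => e1; move: h2; apply/negP; rewrite -ltNge ltr_sqrt; lra.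
Qed.

Theorem lemma11 (R : realType) (beta eta : R)
    (beta_ge0 : 0 <= beta) (beta_neq : beta != 2^-1)
    (eta_range : 1 < Num.sqrt (1 + eta) <= Num.sqrt 2) :
  exists C : R,
    forall (Delta x y z : R), 0 < Delta -> y != z \/ beta < 2^-1 ->
    forall (d : measure_display) (Omega : measurableType d)
      (P : probability Omega R) (B : R -> Omega -> R)
      (L : Omega -> cumulative R R),
    is_brownian_bridge P B (Num.sqrt (1 + eta)) Delta y x ->
    is_local_time P B (Num.sqrt (1 + eta)) Delta z L ->
    (\int[P]_w \int[lebesgue_stieltjes_measure (L w)]_(s in `]0%R, Delta])
        (s `^ (- beta))%:E
     <= (C * Delta `^ (2^-1 - beta) *
          (1 + `|(y - z) / Num.sqrt Delta| `^ Num.min (1 - 2 * beta) 0 *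
               expR (- ((y - z) ^+ 2 / (eta * Delta))) *
               expR (eta * ((x - y) ^+ 2 / Delta))))%:E)%E.
Proof.
have [eta0 eta1] := eta_gt0_le1 eta_range.
have [C hC] := bridge_weighted_occupation_le beta_ge0 beta_neq eta0 eta1.
exists C => T x y z T0 yz d Omega P B L bB lL.
have sigma2 : Num.sqrt (1 + eta) ^+ 2 = 1 + eta by rewrite sqr_sqrtr; lra.
have [N [mN N0 sN]] := bridge_continuous bB.
pose E := ~` N.
have mE : measurable E by exact: measurableC.
have cE w : E w -> {within `[0, T], continuous (fun t => B t w)}.
  by move=> Ew; apply: contrapT => h; exact/Ew/sN.
have aeE : {ae P, forall w, E w}.
  by exists N; split => // w /= h; apply: contrapT.
(* Windows at most half as wide as the distance from [z] to the starting point; any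
   width will do when [y = z]. *)
pose delta : R := if y == z then 1 else `|y - z| / 2.
have delta0 : 0 < delta.
  by rewrite /delta; case: eqVneq => // yz'; rewrite divr_gt0// normr_gt0 subr_eq0.
pose e (n : nat) : R := delta / n.+1%:R.
have e0 n : 0 < e n by rewrite divr_gt0.
have e_le n : y = z \/ e n <= `|y - z| / 2.
  have : e n <= delta by rewrite /e ler_pdivrMr// ler_peMr ?(ltW delta0)// ler1n.
  by rewrite /delta; case: eqVneq => [->|_]; [left|right].
have e_cvg : e n @[n --> \oo] --> 0.
  by rewrite -(mulr0 delta); apply: cvgM; [exact: cvg_cst|exact: cvg_harmonic].
have mB := bridge_measurable bB.
pose g n w s : \bar R := ((1 + eta) / e n * \1_(hitting_graph B T E z (e n)) (s, w))%:E.
pose X n w : \bar R := (\int[lebesgue_measure]_(s in `]0%R, T]) ((s `^ (- beta))%:E * g n w s))%E.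
have g0 n w s : (0 <= g n w s)%E.
  by rewrite lee_fin mulr_ge0// divr_ge0 ?(ltW (e0 n))//; lra.
have mA n : measurable (hitting_graph B T E z (e n)) by exact: measurable_hitting_graph.
have mX n : measurable_fun setT (X n).
  pose f (p : R * Omega) : \bar R :=
    ((p.1 `^ (- beta))%:E * g n p.2 p.1)%E.
  have mf : measurable_fun setT f.
    apply: emeasurable_funM; apply/measurable_EFinP.
      by apply: (@measurableT_comp _ _ _ _ _ _ (fun s : R => s `^ (- beta)) _ (@fst R Omega)).
    apply: measurable_funM => //.
    rewrite (_ : (fun p => _) = \1_(hitting_graph B T E z (e n))).
      exact: measurable_indic.
    by apply/funext => -[].
  have f0 p : (0 <= f p)%E by rewrite mule_ge0// lee_fin powR_ge0.
  exact: (fubini_restrict_l P (measurable_itv `]0, T]) mf f0).1.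
have X0 n w : (0 <= X n w)%E.
  by apply: integral_ge0 => s _; rewrite mule_ge0// lee_fin powR_ge0.
have hle : (\int[P]_w \int[lebesgue_stieltjes_measure (L w)]_(s in `]0%R, T]) (s `^ (- beta))%:E
    <= \int[P]_w limn_einf (fun n => X n w))%E.
  apply: le_integral_ae_pointwise.
  - exact: measurable_limn_einf.
  - by move=> w; apply: integral_ge0 => s _; rewrite lee_fin powR_ge0.
  - move=> w; apply: (@le_limn_einf_cvg _ (fun=> 0%E)) => //; exact: cvg_cst.
  have := local_time_limit lL; apply: filterS2 aeE => w Ew lim.
  pose A n t : R := (e n)^-1 * (\int[lebesgue_measure]_(s in `[0%R, t])
     (\1_(`[z, z + e n[) (B s w) * (1 + eta))).
  (* On a good path, [A n] converges to the local time along the widths [e n]. *)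
  apply: (@stieltjes_le_limn_einf _ _ _ _ _ A) => //.
  - move=> n; apply: measurable_funTS; apply/measurable_EFinP.
    apply: measurable_funM => //.
    apply: (@measurableT_comp _ _ _ _ _ _
      (\1_(hitting_graph B T E z (e n)) : R * Omega -> R) _ (fun s : R => (s, w))) => //.
  - move=> n a b a0 ab bT.
    rewrite -(@occupation_increment _ T a b (1 + eta) (e n) z (fun s => B s w))//; last first.
      apply: subspace_continuous_measurable_fun; [exact: measurable_itv|exact: cE].
    apply: eq_integral => s; rewrite inE/= in_itv/= => /andP[as_ sb].
    rewrite /g !indicE; congr ((_ * (nat_of_bool _)%:R)%:E).
    apply/idP/idP => /set_mem h; apply/mem_set; first by case: h.
    split => //; split => //=; rewrite in_itv/=; apply/andP; split; lra.
  - move=> t t0T; have := lim t; rewrite in_itv/= => /(_ t0T)/cvg_at_rightP/(_ e (conj e0 e_cvg)).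
    by rewrite sigma2.
apply: (le_trans hle); apply: (le_trans (fatou _ _ _ _)) => //.
apply: limn_einf_le_bound => n.
exact: hC.
Qed.
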